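(* Let $A = \mathbb{Z}$ or $A = \mathbb{Z}_p$ (the $p$-adic integers, for a prime integer $p$), let $R = A[x_1,\dots,x_d]$ be a polynomial ring, and let $Q$ be a prime ideal of $R$ such that $Q \cap A = (0)$. Then $Q^{(n)} = Q^{\langle n\rangle_A}$ for all $n \geq 1$.
   Context: All rings are commutative with identity. For a prime ideal $Q$ of a ring $R$ and $n\ge 1$, the $n$-th symbolic power of $Q$ is $Q^{(n)} = Q^nR_Q\cap R$ (the preimage of $Q^nR_Q$ under $R\to R_Q$). For a ring map $B\to S$, the sets of $B$-linear differential operators on $S$ of order at most $n$ are defined inductively: $D^0_{S|B}=\mathrm{Hom}_S(S,S)\subseteq \mathrm{Hom}_B(S,S)$ (multiplications by elements of $S$), and for $n\ge 1$, $D^n_{S|B}=\{\partial\in \mathrm{Hom}_B(S,S) \mid [\partial,f]=\partial\circ f-f\circ\partial\in D^{n-1}_{S|B} \text{ for all } f\in D^0_{S|B}\}$. For an ideal $I$ of $S$, with $B$ a subring of $S$, and $n\ge 1$, the $n$-th ($B$-linear) differential power of $I$ is $I^{\langle n\rangle_B}=\{f\in S\mid \partial(f)\in I \text{ for all } \partial\in D^{n-1}_{S|B}\}$. *)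

(* Defs.v *)
From HB Require Import structures.
From mathcomp Require Import all_boot all_order all_algebra.
From mathcomp Require Import generic_quotient ring_quotient ring.
From mathcomp Require Import boolp classical_sets.
From mathcomp Require Import mpoly.

Set Implicit Arguments.
Unset Strict Implicit.
Unset Printing Implicit Defensive.

Import GRing.Theory.

Local Open Scope classical_set_scope.
Local Open Scope quotient_scope.
Local Open Scope ring_scope.

(* The p-adic integers, as the inverse limit of the rings Z/p^(n+1), n >= 0.  *)
(* The construction goes through for every p, but is meant for p prime:       *)
(* 'Z_m is Z/m only when m > 1.                                               *)
Section PadicIntegers.
Variable p : nat.

Local Notation Zpn n := 'Z_(p ^ n.+1).

Definition Zpn_red n (a : Zpn n.+1) : Zpn n := (a : nat)%:R.

Record padic_int := PadicInt {
  padic_res :> forall n, Zpn n;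
  padic_resP : forall n, Zpn_red (padic_res n.+1) = padic_res n }.

HB.instance Definition _ := gen_eqMixin padic_int.
HB.instance Definition _ := gen_choiceMixin padic_int.

Lemma padic_intP (x y : padic_int) : (forall n, x n = y n) -> x = y.
Proof.
case: x y => [x hx] [y hy] /= exy.
have {}exy : x = y by apply: functional_extensionality_dep.
by subst y; congr PadicInt; apply: Prop_irrelevance.
Qed.

Lemma Zpn_dvd n : ((Zp_trunc (p ^ n.+1)).+2 %| (Zp_trunc (p ^ n.+2)).+2)%N.
Proof.
case: p => [|[|q]]; rewrite ?exp1n ?exp0n //.
by rewrite !Zp_cast ?(ltn_exp2l 0) // dvdn_exp2l.
Qed.

Lemma Zpn_red_nat n k : Zpn_red (k%:R : Zpn n.+1) = k%:R.
Proof.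
rewrite /Zpn_red; apply: val_inj; rewrite !Zp_nat /=.
by rewrite modn_dvdm // Zpn_dvd.
Qed.

Lemma Zpn_redD n : {morph @Zpn_red n : a b / a + b}.
Proof.
by move=> a b; rewrite -[a]natr_Zp -[b]natr_Zp -natrD !Zpn_red_nat natrD.
Qed.

Lemma Zpn_redM n : {morph @Zpn_red n : a b / a * b}.
Proof.
by move=> a b; rewrite -[a]natr_Zp -[b]natr_Zp -natrM !Zpn_red_nat natrM.
Qed.

Lemma Zpn_redN n : {morph @Zpn_red n : a / - a}.
Proof.
move=> a; apply/eqP; rewrite -subr_eq0 opprK -Zpn_redD addNr.
by rewrite (Zpn_red_nat n 0).
Qed.

Definition padic_zero : padic_int :=
  @PadicInt (fun=> 0) (fun n => Zpn_red_nat n 0).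

Definition padic_one : padic_int :=
  @PadicInt (fun=> 1) (fun n => Zpn_red_nat n 1).

Definition padic_opp (x : padic_int) : padic_int :=
  @PadicInt (fun n => - x n)
    (fun n => etrans (Zpn_redN (x n.+1)) (congr1 -%R (padic_resP x n))).

Definition padic_add (x y : padic_int) : padic_int :=
  @PadicInt (fun n => x n + y n)
    (fun n => etrans (Zpn_redD (x n.+1) (y n.+1))
                     (congr2 +%R (padic_resP x n) (padic_resP y n))).

Definition padic_mul (x y : padic_int) : padic_int :=
  @PadicInt (fun n => x n * y n)
    (fun n => etrans (Zpn_redM (x n.+1) (y n.+1))
                     (congr2 *%R (padic_resP x n) (padic_resP y n))).

Lemma padic_addA : associative padic_add.
Proof. by move=> x y z; apply: padic_intP => n /=; rewrite addrA. Qed.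
Lemma padic_addC : commutative padic_add.
Proof. by move=> x y; apply: padic_intP => n /=; rewrite addrC. Qed.
Lemma padic_add0 : left_id padic_zero padic_add.
Proof. by move=> x; apply: padic_intP => n /=; rewrite add0r. Qed.
Lemma padic_addN : left_inverse padic_zero padic_opp padic_add.
Proof. by move=> x; apply: padic_intP => n /=; rewrite addNr. Qed.
Lemma padic_mulA : associative padic_mul.
Proof. by move=> x y z; apply: padic_intP => n /=; rewrite mulrA. Qed.
Lemma padic_mulC : commutative padic_mul.
Proof. by move=> x y; apply: padic_intP => n /=; rewrite mulrC. Qed.
Lemma padic_mul1 : left_id padic_one padic_mul.
Proof. by move=> x; apply: padic_intP => n /=; rewrite mul1r. Qed.
Lemma padic_mulD : left_distributive padic_mul padic_add.
Proof. by move=> x y z; apply: padic_intP => n /=; rewrite mulrDl. Qed.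
Lemma padic_1neq0 : padic_one != padic_zero.
Proof.
by apply/eqP => /(congr1 (fun x : padic_int => x 0%N)) /eqP; rewrite oner_eq0.
Qed.

HB.instance Definition _ := GRing.isZmodule.Build padic_int
  padic_addA padic_addC padic_add0 padic_addN.
HB.instance Definition _ := GRing.Zmodule_isComNzRing.Build padic_int
  padic_mulA padic_mulC padic_mul1 padic_mulD padic_1neq0.

End PadicIntegers.

(* The localization of R at the prime ideal Q: fractions r / s with s not in  *)
(* Q, where r / s = r' / s' iff u (r s' - r' s) = 0 for some u not in Q.      *)
Section Localization.
Variables (R : comNzRingType) (Q : prime_idealr R).
Local Notation I := (Q : pred R).

Definition loc_den := {s : R | s \notin I}.

Lemma loc_den1_subproof : 1 \notin I. Proof. by rewrite idealr1. Qed.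
Definition loc_den1 : loc_den := exist _ 1 loc_den1_subproof.

Lemma loc_denM_subproof (s t : loc_den) : sval s * sval t \notin I.
Proof. by rewrite prime_idealrM negb_or (valP s) (valP t). Qed.
Definition loc_denM (s t : loc_den) : loc_den :=
  exist _ (sval s * sval t) (loc_denM_subproof s t).

Definition loc_frac := (R * loc_den)%type.
Implicit Types x y z : loc_frac.

Definition loc_equiv x y : bool :=
  `[< exists u : loc_den, sval u * (x.1 * sval y.2 - y.1 * sval x.2) = 0 >].

Lemma loc_equivP x y :
  reflect (exists u : loc_den, sval u * (x.1 * sval y.2 - y.1 * sval x.2) = 0)
          (loc_equiv x y).
Proof. exact: asboolP. Qed.

Lemma loc_equiv_is_equiv : equiv_class_of loc_equiv.
Proof.
split=> [x|x y|y x z].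
- by apply/loc_equivP; exists loc_den1; rewrite subrr mulr0.
- case: x y => [a s] [b t]; apply/loc_equivP/loc_equivP => -[u /= e]; exists u;
    by apply: oppr_inj; rewrite oppr0 -{}e /=; ring.
- case: x y z => [a s] [b t] [c r] /loc_equivP[u /= e] /loc_equivP[v /= f].
  apply/loc_equivP; exists (loc_denM (loc_denM u v) t) => /=.
  transitivity (sval v * sval r * (sval u * (a * sval t - b * sval s))
              + sval u * sval s * (sval v * (b * sval r - c * sval t))); first ring.
  by rewrite e f !mulr0 addr0.
Qed.

Canonical loc_equiv_equiv := EquivRelPack loc_equiv_is_equiv.
Canonical loc_equiv_encModRel := defaultEncModRel loc_equiv.

Definition localization := {eq_quot loc_equiv}.
HB.instance Definition _ : EqQuotient loc_frac loc_equiv localization :=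
  EqQuotient.on localization.
HB.instance Definition _ := Choice.on localization.

Definition fzero : loc_frac := (0, loc_den1).
Definition fone : loc_frac := (1, loc_den1).
Definition fopp x : loc_frac := (- x.1, x.2).
Definition fadd x y : loc_frac :=
  (x.1 * sval y.2 + y.1 * sval x.2, loc_denM x.2 y.2).
Definition fmul x y : loc_frac := (x.1 * y.1, loc_denM x.2 y.2).

Lemma fracP x y :
  reflect (exists u : loc_den, sval u * (x.1 * sval y.2 - y.1 * sval x.2) = 0)
          (x == y %[mod localization]).
Proof. by rewrite piE /=; apply: loc_equivP. Qed.

Lemma fracE x y :
  x.1 * sval y.2 = y.1 * sval x.2 ->
  \pi_localization x = \pi_localization y.
Proof. by move=> e; apply/eqP/fracP; exists loc_den1; rewrite e subrr mulr0. Qed.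

Definition loc_zero : localization := \pi_localization fzero.
Definition loc_one : localization := \pi_localization fone.
Definition loc_opp := lift_op1 localization fopp.
Definition loc_add := lift_op2 localization fadd.
Definition loc_mul := lift_op2 localization fmul.

Lemma pi_fopp x : loc_opp (\pi_localization x) = \pi_localization (fopp x).
Proof.
unlock loc_opp; case: piP; case: x => [a s] [b t] /eqP/fracP [u /= e].
apply/eqP/fracP; exists u => /=.
by rewrite -{}e /=; ring.
Qed.

Lemma pi_fadd x y :
  loc_add (\pi_localization x) (\pi_localization y)
  = \pi_localization (fadd x y).
Proof.
unlock loc_add; case: x y => [a s] [b t].
case: piP => -[a' s'] /eqP/fracP [u /= e]; case: piP => -[b' t'] /eqP/fracP [v /= f].
apply/eqP/fracP; exists (loc_denM u v) => /=.
move: (sval u) (sval v) (sval s) (sval t) (sval s') (sval t') e f => /=.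
move=> {}u {}v {}s {}t {}s' {}t' e f.
transitivity (- (v * t * t' * (u * (a * s' - a' * s))
                 + u * s * s' * (v * (b * t' - b' * t)))); first ring.
by rewrite e f !mulr0 addr0 oppr0.
Qed.

Lemma pi_fmul x y :
  loc_mul (\pi_localization x) (\pi_localization y)
  = \pi_localization (fmul x y).
Proof.
unlock loc_mul; case: x y => [a s] [b t].
case: piP => -[a' s'] /eqP/fracP [u /= e]; case: piP => -[b' t'] /eqP/fracP [v /= f].
apply/eqP/fracP; exists (loc_denM u v) => /=.
move: (sval u) (sval v) (sval s) (sval t) (sval s') (sval t') e f => /=.
move=> {}u {}v {}s {}t {}s' {}t' e f.
transitivity (- (v * b * t' * (u * (a * s' - a' * s))
                 + u * a' * s * (v * (b * t' - b' * t)))); first ring.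
by rewrite e f !mulr0 addr0 oppr0.
Qed.

Lemma loc_addA : associative loc_add.
Proof.
elim/quotW => -[a s]; elim/quotW => -[b t]; elim/quotW => -[c r].
by rewrite !pi_fadd; apply: fracE => /=; ring.
Qed.
Lemma loc_addC : commutative loc_add.
Proof.
elim/quotW => -[a s]; elim/quotW => -[b t].
by rewrite !pi_fadd; apply: fracE => /=; ring.
Qed.
Lemma loc_add0 : left_id loc_zero loc_add.
Proof. by elim/quotW => -[a s]; rewrite pi_fadd; apply: fracE => /=; ring. Qed.
Lemma loc_addN : left_inverse loc_zero loc_opp loc_add.
Proof. by elim/quotW => -[a s]; rewrite pi_fopp pi_fadd; apply: fracE => /=; ring. Qed.
Lemma loc_mulA : associative loc_mul.
Proof.
elim/quotW => -[a s]; elim/quotW => -[b t]; elim/quotW => -[c r].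
by rewrite !pi_fmul; apply: fracE => /=; ring.
Qed.
Lemma loc_mulC : commutative loc_mul.
Proof.
elim/quotW => -[a s]; elim/quotW => -[b t].
by rewrite !pi_fmul; apply: fracE => /=; ring.
Qed.
Lemma loc_mul1 : left_id loc_one loc_mul.
Proof. by elim/quotW => -[a s]; rewrite pi_fmul; apply: fracE => /=; ring. Qed.
Lemma loc_mulD : left_distributive loc_mul loc_add.
Proof.
elim/quotW => -[a s]; elim/quotW => -[b t]; elim/quotW => -[c r].
by rewrite !(pi_fadd, pi_fmul); apply: fracE => /=; ring.
Qed.
Lemma loc_1neq0 : loc_one != loc_zero.
Proof.
apply/negP => /fracP [u] /=; rewrite mul0r subr0 !mulr1 => u0.
by move: (svalP u); rewrite u0 rpred0.
Qed.

HB.instance Definition _ := GRing.isZmodule.Build localization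
  loc_addA loc_addC loc_add0 loc_addN.
HB.instance Definition _ := GRing.Zmodule_isComNzRing.Build localization
  loc_mulA loc_mulC loc_mul1 loc_mulD loc_1neq0.

Definition loc_map (r : R) : localization := \pi_localization (r, loc_den1).

Lemma loc_map_is_zmod_morphism : zmod_morphism loc_map.
Proof.
move=> a b; rewrite /loc_map -[RHS]/(loc_add _ (loc_opp _)) pi_fopp pi_fadd.
by apply: fracE => /=; ring.
Qed.
Lemma loc_map_is_monoid_morphism : monoid_morphism loc_map.
Proof.
split=> // a b; rewrite /loc_map -[RHS]/(loc_mul _ _) pi_fmul.
by apply: fracE => /=; ring.
Qed.
HB.instance Definition _ :=
  GRing.isZmodMorphism.Build R localization loc_map loc_map_is_zmod_morphism.
HB.instance Definition _ :=
  GRing.isMonoidMorphism.Build R localization loc_map loc_map_is_monoid_morphism.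

End Localization.

Section Ideals.
Variable R : comNzRingType.

Definition ideal_span (G : set R) : set R :=
  [set x | exists (m : nat) (a g : 'I_m -> R),
             (forall i, G (g i)) /\ x = \sum_(i < m) a i * g i].

Definition ideal_power (I : {pred R}) (n : nat) : set R :=
  ideal_span [set x | exists q : 'I_n -> R,
                        (forall i, q i \in I) /\ x = \prod_(i < n) q i].

End Ideals.

Definition symbolic_power (R : comNzRingType) (Q : prime_idealr R) (n : nat) :
    set R :=
  loc_map Q @^-1` ideal_span (loc_map Q @` ideal_power Q n).

Section DifferentialOperators.
Variables (B : comNzRingType) (S : comAlgType B).

(* The elements of Hom_S(S, S), all of which are B-linear.                    *)
Definition multiplication (f : S -> S) : Prop := exists s : S, f =1 *%R s.

Fixpoint diff_op (n : nat) (f : S -> S) : Prop :=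
  if n is m.+1 then
    linear f /\ forall g, multiplication g -> diff_op m ((f \o g) \- (g \o f))
  else multiplication f.

(* Only n >= 1 is meaningful: n = 0 gives the same set as n = 1.              *)
Definition differential_power (I : {pred S}) (n : nat) : set S :=
  [set x | forall f : S -> S, diff_op n.-1 f -> f x \in I].

End DifferentialOperators.

Arguments differential_power B {S} I n.

(* Main.v *)
Require Import Defs.
From mathcomp Require Import all_boot all_order all_algebra.
From mathcomp Require Import ring_quotient classical_sets mpoly.
From mathcomp Require Import boolp generic_quotient ring.

Local Open Scope quotient_scope.
Local Open Scope ring_scope.

Import GRing.Theory.

Set Implicit Arguments.
Unset Strict Implicit.
Unset Printing Implicit Defensive.

(** The inclusion of the symbolic power in the differential power is formal.
    Commutators lower the order of a differential operator, so an operator of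
    order at most $n-1$ maps $Q^n$ into $Q$; moving a denominator
    $s\notin Q$ across the operator costs one more commutator, whence the same
    for $Q^{(n)}$ (diff_op_symbolic_power).

    For the other inclusion, the point is to find a vector field
    $E = \sum_i e_i\,\partial_i$ with all $e_i\in Q$ and some
    $\Delta\notin Q$ such that $E$ acts on $Q/Q^{(2)}$ as multiplication by
    $\Delta$ (exists_euler). Geometrically, $e_i/\Delta$ is $x_i - y_i$,
    where $x_i\mapsto y_i$ is a section of $R_Q/Q^2R_Q\to R_Q/QR_Q$, and the
    property of $E$ is the first order Taylor formula. By the product rule $E$
    then satisfies Euler's identity: it acts on $Q^{(n)}/Q^{(n+1)}$ as
    multiplication by $n\Delta$ (euler_symbolic). Now induct on $n$. If $f$
    is in the differential power of exponent $n+1$, then $f$ and all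
    $\partial_i f$ are in the one of exponent $n$, hence in $Q^{(n)}$; so
    $E(f) = \sum_i e_i\,\partial_i f\in Q^{(n+1)}$, and Euler's identity
    gives $n\Delta f\in Q^{(n+1)}$. As $A$ has characteristic zero and
    $Q\cap A = 0$, the integer $n$ is not in $Q$; so $n\Delta\notin Q$ and
    $f\in Q^{(n+1)}$.

    The vector field is built one variable at a time (euler_adjoin). Let $E$
    and $\Delta$ work for the elements of $Q$ lying in a subring $S$, and let
    $x$ be the next variable. If every polynomial relation for $x$ over
    $S$ modulo $Q$ has its coefficients in $Q$ ($x$ is transcendental modulo
    $Q$), the same $E$ works for $S[x]$. Otherwise take a relation $G$
    of minimal degree whose leading coefficient is not in $Q$. In
    characteristic zero $\partial_x G\notin Q$ by minimality, and
    $\partial_x G\cdot E + (\Delta G - E(G))\,\partial_x$ is a field that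
    multiplies $G$ exactly by $\Delta\,\partial_x G$; pseudo-division by $G$
    shows that it works for $S[x]$. This is one step of Newton's method for
    the root $y$ of $G$. *)

(** * Powers and symbolic powers *)

Section SymbolicPowers.
Variables (R : comNzRingType) (Q : prime_idealr R).
Implicit Types (f g s : R) (n m : nat).

Lemma ideal_power0 f : ideal_power Q 0 f.
Proof.
exists 1%N, (fun=> f), (fun=> 1); split; last by rewrite big_ord1 mulr1.
by move=> _; exists (fun=> 0); split=> [[]//|]; rewrite big_ord0.
Qed.

Lemma ideal_power_zero n : ideal_power Q n 0.
Proof. by exists 0%N, (fun=> 0), (fun=> 0); split=> [[]//|]; rewrite big_ord0. Qed.

Lemma ideal_powerD n f g :
  ideal_power Q n f -> ideal_power Q n g -> ideal_power Q n (f + g).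
Proof.
move=> [k [a [u [hu ->]]]] [l [b [v [hv ->]]]].
exists (k + l)%N, (fun i => match split i with inl j => a j | inr j => b j end),
  (fun i => match split i with inl j => u j | inr j => v j end); split.
  by move=> i; case: (split i).
rewrite big_split_ord /=; congr (_ + _); apply: eq_bigr => i _.
  by rewrite -/(unsplit (inl i)) unsplitK.
by rewrite -/(unsplit (inr i)) unsplitK.
Qed.

Lemma ideal_powerMl n a f : ideal_power Q n f -> ideal_power Q n (a * f).
Proof.
move=> [k [b [u [hu ->]]]]; exists k, (fun i => a * b i), u; split=> //.
by rewrite mulr_sumr; apply: eq_bigr => i _; rewrite mulrA.
Qed.

(** Since $Q^{n+1} = Q\cdot Q^n$, a property compatible with sums can be
    checked one factor at a time; scalars are absorbed into the factor in
    $Q$. *)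
Lemma ideal_powerS_ind n (P : R -> Prop) :
    P 0 -> (forall f g, P f -> P g -> P (f + g)) ->
    (forall q g, q \in (Q : pred R) -> ideal_power Q n g -> P (q * g)) ->
  forall f, ideal_power Q n.+1 f -> P f.
Proof.
move=> P0 PD PM f [k [a [u [hu ->]]]].
apply: (big_ind P) => // i _; have [q [hq ->]] := hu i.
rewrite big_ord_recl mulrA; apply: PM; first exact: idealMr.
exists 1%N, (fun=> 1), (fun=> \prod_(j < n) q (lift ord0 j)).
split; last by rewrite big_ord1 mul1r.
by move=> _; exists (fun j => q (lift ord0 j)).
Qed.

Lemma ideal_powerSM n q g :
  q \in (Q : pred R) -> ideal_power Q n g -> ideal_power Q n.+1 (q * g).
Proof.
move=> qQ [k [a [u [hu ->]]]]; exists k, a, (fun i => q * u i); split.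
  move=> i; have [v [hv ->]] := hu i.
  exists (fun j => oapp v q (unlift ord0 j)); split.
    by move=> j; case: (unlift ord0 j) => [l|] //=.
  rewrite big_ord_recl unlift_none; congr (_ * _).
  by apply: eq_bigr => j _; rewrite liftK.
by rewrite mulr_sumr; apply: eq_bigr => i _; ring.
Qed.

Lemma ideal_powerW n f : ideal_power Q n.+1 f -> ideal_power Q n f.
Proof.
apply: (@ideal_powerS_ind n (ideal_power Q n)) => [||q g _].
- exact: ideal_power_zero.
- exact: ideal_powerD.
- exact: ideal_powerMl.
Qed.

Lemma ideal_power1 f : ideal_power Q 1 f <-> f \in (Q : pred R).
Proof.
split; last by move=> fQ; rewrite -[f]mulr1; apply: ideal_powerSM;
  last exact: ideal_power0.
apply: (@ideal_powerS_ind 0 (fun f => f \in (Q : pred R))) => [||q g qQ _].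
- exact: rpred0.
- by move=> a b aQ bQ; apply: rpredD.
- by rewrite mulrC; apply: idealMr.
Qed.

Lemma ideal_powerM m n f g :
  ideal_power Q m f -> ideal_power Q n g -> ideal_power Q (m + n) (f * g).
Proof.
move=> + gn; elim: m f => [|m IH] f; first by move=> _; apply: ideal_powerMl.
apply: (@ideal_powerS_ind m (fun f => ideal_power Q (m.+1 + n) (f * g))).
- by rewrite mul0r; apply: ideal_power_zero.
- by move=> a b; rewrite mulrDl; apply: ideal_powerD.
- move=> q h qQ hm; rewrite -mulrA addSn.
  by apply: ideal_powerSM => //; apply: IH.
Qed.

Definition in_symbolic_power n f : Prop :=
  exists2 s, s \notin (Q : pred R) & ideal_power Q n (s * f).

Local Notation symb := in_symbolic_power.

Lemma notin_prime_idealM s t :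
  s \notin (Q : pred R) -> t \notin (Q : pred R) -> s * t \notin (Q : pred R).
Proof. by move=> hs ht; rewrite prime_idealrM negb_or hs ht. Qed.

Lemma notin_prime_ideal1 : 1 \notin (Q : pred R).
Proof. by rewrite idealr1. Qed.

Lemma ideal_power_symbolic n f : ideal_power Q n f -> symb n f.
Proof. by move=> fn; exists 1; [apply: notin_prime_ideal1|rewrite mul1r]. Qed.

Lemma symbolic_zero n : symb n 0.
Proof. exact/ideal_power_symbolic/ideal_power_zero. Qed.

Lemma symbolicM m n f g : symb m f -> symb n g -> symb (m + n) (f * g).
Proof.
move=> [s sQ hf] [t tQ hg]; exists (s * t); first exact: notin_prime_idealM.
by rewrite mulrACA; apply: ideal_powerM.
Qed.

Lemma symbolicMl n a f : symb n f -> symb n (a * f).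
Proof.
by move=> [s sQ hf]; exists s => //; rewrite mulrCA; apply: ideal_powerMl.
Qed.

Lemma symbolicD n f g : symb n f -> symb n g -> symb n (f + g).
Proof.
move=> [s sQ hf] [t tQ hg]; exists (s * t); first exact: notin_prime_idealM.
rewrite (_ : s * t * _ = t * (s * f) + s * (t * g)); last by ring.
by apply: ideal_powerD; apply: ideal_powerMl.
Qed.

Lemma symbolicB n f g : symb n f -> symb n g -> symb n (f - g).
Proof. by move=> hf hg; rewrite -mulN1r; apply: symbolicD => //; apply: symbolicMl. Qed.

Lemma symbolic_sum n (I : finType) (F : I -> R) :
  (forall i, symb n (F i)) -> symb n (\sum_i F i).
Proof.
by move=> hF; apply: big_ind => //; [apply: symbolic_zero|apply: symbolicD].
Qed.

Lemma symbolic_sat n s f : s \notin (Q : pred R) -> symb n (s * f) -> symb n f.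
Proof.
move=> sQ [t tQ hf]; exists (t * s); first exact: notin_prime_idealM.
by rewrite -mulrA.
Qed.

Lemma symbolic1 f : symb 1 f <-> f \in (Q : pred R).
Proof.
split; last by move=> fQ; apply/ideal_power_symbolic/ideal_power1.
by move=> [s sQ /ideal_power1]; rewrite prime_idealrM (negPf sQ).
Qed.

(** An element of the extended ideal $Q^nR_Q$ is a finite sum of fractions,
    and becomes the image of an element of $Q^n$ once denominators are cleared;
    equality in $R_Q$ is in turn equality in $R$ up to a factor outside $Q$. *)
Lemma symbolic_powerP n f : symbolic_power Q n f <-> symb n f.
Proof.
split; last first.
  move=> [s sQ hf]; pose u : loc_den Q := exist _ s sQ.
  exists 1%N, (fun=> \pi_(localization Q) (1, u)), (fun=> loc_map Q (s * f)).
  split; first by move=> _; exists (s * f).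
  rewrite big_ord1 /loc_map -[RHS]/(loc_mul _ _) pi_fmul.
  by apply: fracE => /=; ring.
pose clear (z : localization Q) :=
  exists s, exists2 g, s \notin (Q : pred R) & ideal_power Q n g /\
    loc_map Q s * z = loc_map Q g.
have clear_f : symbolic_power Q n f -> clear (loc_map Q f).
  move=> [k [a [u [hu ->]]]]; apply: (big_ind clear).
  - exists 1, 0; first exact: notin_prime_ideal1.
    by split; [apply: ideal_power_zero|rewrite rmorph0 mulr0].
  - move=> y z [s [g sQ [hg eg]]] [t [h tQ [hh eh]]].
    exists (s * t), (t * g + s * h); first exact: notin_prime_idealM.
    split; first by apply: ideal_powerD; apply: ideal_powerMl.
    by rewrite rmorphD !rmorphM /= -eg -eh; ring.
  - move=> i _; have [g hg <-] := hu i; elim/quotW: (a i) => -[b t].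
    exists (sval t), (b * g); first exact: (valP t).
    split; first exact: ideal_powerMl.
    rewrite mulrA rmorphM; congr (_ * _).
    rewrite /loc_map -[LHS]/(loc_mul _ _) pi_fmul.
    by apply: fracE => /=; ring.
move=> /clear_f[s [g sQ [hg]]]; rewrite -rmorphM => /eqP/fracP[u /= e].
exists (sval u * s); first by apply: notin_prime_idealM => //; apply: (valP u).
suff -> : sval u * s * f = sval u * g by apply: ideal_powerMl.
by apply/eqP; rewrite -subr_eq0; apply/eqP; rewrite -e; ring.
Qed.

End SymbolicPowers.

(** * Euler derivations *)

Section Derivations.
Variable R : comNzRingType.

Definition derivation (D : R -> R) : Prop :=
  zmod_morphism D /\ forall f g, D (f * g) = D f * g + f * D g.

Variables (D : R -> R) (derD : derivation D).

Lemma derivationB : {morph D : f g / f - g}. Proof. exact: derD.1. Qed.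

Lemma derivation_zero : D 0 = 0.
Proof. by rewrite -[X in D X](subrr 0) derivationB subrr. Qed.

Lemma derivationD : {morph D : f g / f + g}.
Proof.
by move=> f g; rewrite -[g in LHS]opprK -[- g]add0r !derivationB derivation_zero sub0r opprK.
Qed.

Lemma derivationM f g : D (f * g) = D f * g + f * D g.
Proof. exact: derD.2. Qed.

Lemma derivation_horner (P : {poly R}) x :
  (forall i, D P`_i = 0) -> D P.[x] = P^`().[x] * D x.
Proof.
elim/poly_ind: P => [|P c IH] hP; first by rewrite deriv0 !horner0 derivation_zero mul0r.
have Dc : D c = 0 by move: (hP 0%N); rewrite coefD coefMX coefC /= add0r.
have DP i : D P`_i = 0 by move: (hP i.+1); rewrite coefD coefMX coefC /= addr0.
rewrite derivD derivM derivX derivC !hornerE derivationD Dc derivationM IH //; ring.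
Qed.

End Derivations.

Section EulerDerivations.
Variables (R : comNzRingType) (Q : prime_idealr R).
Local Notation symb := (in_symbolic_power Q).

Variables (E : R -> R) (Delta : R).
Hypotheses (derE : derivation E) (EQ : forall f, E f \in (Q : pred R)).

(** $E$ multiplies the class of $f$ modulo $Q^{(2)}$ by $\Delta$. On $Q$ this
    condition cuts out an ideal (eulerD, eulerMl) from which factors outside
    $Q$ can be cancelled (euler_sat), so it only has to be tested on
    generators of $Q$ up to such factors. *)
Definition euler f : Prop := symb 2 (E f - Delta * f).

Lemma euler0 : euler 0.
Proof. by rewrite /euler (derivation_zero derE) mulr0 subrr; apply: symbolic_zero. Qed.

Lemma eulerD f g : euler f -> euler g -> euler (f + g).
Proof.
rewrite /euler (derivationD derE) => hf hg.
by rewrite (_ : _ - _ = (E f - Delta * f) + (E g - Delta * g));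
  [apply: symbolicD | ring].
Qed.

Lemma eulerMl a f : f \in (Q : pred R) -> euler f -> euler (a * f).
Proof.
rewrite /euler (derivationM derE) => fQ hf.
rewrite (_ : _ - _ = E a * f + a * (E f - Delta * f)); last by ring.
apply: symbolicD; last exact: symbolicMl.
by rewrite -[2%N]/(1 + 1)%N; apply: symbolicM; apply/symbolic1.
Qed.

Lemma euler_sat s f : s \notin (Q : pred R) -> f \in (Q : pred R) ->
  euler (s * f) -> euler f.
Proof.
rewrite /euler (derivationM derE) => sQ fQ hf; apply: (symbolic_sat sQ).
rewrite (_ : s * _ = (E s * f + s * E f - Delta * (s * f)) - E s * f); last by ring.
apply: symbolicB => //.
by rewrite -[2%N]/(1 + 1)%N; apply: symbolicM; apply/symbolic1.
Qed.

(** Euler's identity. The product rule gives, for $q\in Q$ and $g\in Q^n$,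
    $$E(qg) - (n+1)\Delta qg = (E(q) - \Delta q)g + q(E(g) - n\Delta g),$$
    and both terms lie in $Q^{(n+2)}$ by induction. *)
Lemma euler_symbolic n f : (forall q, q \in (Q : pred R) -> euler q) ->
  symb n f -> symb n.+1 (E f - n%:R * Delta * f).
Proof.
move=> eulerQ.
have pow : forall f, ideal_power Q n f -> symb n.+1 (E f - n%:R * Delta * f).
  elim: n {f} => [f _|n IH].
    by rewrite !mul0r subr0; apply/symbolic1.
  apply: ideal_powerS_ind => [|f g hf hg|q g qQ gn].
  - by rewrite (derivation_zero derE) mulr0 subrr; apply: symbolic_zero.
  - rewrite (derivationD derE).
    rewrite (_ : _ - _ = (E f - n.+1%:R * Delta * f) +
                           (E g - n.+1%:R * Delta * g)); [exact: symbolicD | ring].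
  - rewrite (derivationM derE) (_ : _ - _ =
      (E q - Delta * q) * g + q * (E g - n%:R * Delta * g)); last first.
      by rewrite -natr1; ring.
    apply: symbolicD; last by rewrite -add1n; apply: symbolicM; [apply/symbolic1|apply: IH].
    rewrite -[n.+2]/(2 + n)%N; apply: symbolicM; first exact: eulerQ.
    exact: ideal_power_symbolic.
move=> fn; have [s sQ hf] := fn; apply: (symbolic_sat sQ).
rewrite (_ : s * _ = (E (s * f) - n%:R * Delta * (s * f)) - E s * f); last first.
  by rewrite (derivationM derE); ring.
apply: symbolicB; first exact: pow.
by rewrite -add1n; apply: symbolicM => //; apply/symbolic1.
Qed.

End EulerDerivations.

(** * Adjoining one variable *)

Section Adjunction.
Variable R : comNzRingType.

Definition subring (S : R -> Prop) : Prop :=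
  [/\ S 1, (forall a b, S a -> S b -> S (a - b))
         & (forall a b, S a -> S b -> S (a * b))].

Variables (S : R -> Prop) (subS : subring S).

Lemma subring1 : S 1. Proof. by case: subS. Qed.
Lemma subringB a b : S a -> S b -> S (a - b). Proof. by case: subS => _ + _; apply. Qed.
Lemma subringM a b : S a -> S b -> S (a * b). Proof. by case: subS => _ _; apply. Qed.
Lemma subring0 : S 0. Proof. by rewrite -(subrr 1); apply: subringB; apply: subring1. Qed.
Lemma subringD a b : S a -> S b -> S (a + b).
Proof.
move=> ha hb; rewrite -[b]opprK -[- b]add0r; do 2!apply: subringB => //.
exact: subring0.
Qed.

Lemma subringMn a n : S a -> S (a *+ n).
Proof.
move=> ha; elim: n => [|n IH]; first by rewrite mulr0n; apply: subring0.
by rewrite mulrS; apply: subringD.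
Qed.

Definition coefs_in (P : {poly R}) : Prop := forall i, S P`_i.

Lemma coefs_inC a : S a -> coefs_in a%:P.
Proof. by move=> ha i; rewrite coefC; case: ifP => // _; apply: subring0. Qed.

Lemma coefs_inX : coefs_in 'X.
Proof. by move=> i; rewrite coefX; case: (_ == _); [apply: subring1|apply: subring0]. Qed.

Lemma coefs_inB P P' : coefs_in P -> coefs_in P' -> coefs_in (P - P').
Proof. by move=> hP hP' i; rewrite coefB; apply: subringB. Qed.

Lemma coefs_inM P P' : coefs_in P -> coefs_in P' -> coefs_in (P * P').
Proof.
move=> hP hP' i; rewrite coefM; apply: big_ind => [||j _]; first exact: subring0.
  exact: subringD.
exact: subringM.
Qed.

Lemma coefs_inXn n : coefs_in 'X^n.
Proof.
elim: n => [|n IH]; last by rewrite exprS; apply: coefs_inM => //; apply: coefs_inX.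
by rewrite expr0; apply: coefs_inC; apply: subring1.
Qed.

Definition adjoin (x : R) (r : R) : Prop := exists2 P, coefs_in P & r = P.[x].

Lemma subring_adjoin x : subring (adjoin x).
Proof.
split; first by exists 1%:P; [apply: coefs_inC; apply: subring1|rewrite hornerC].
  move=> _ _ [P hP ->] [P' hP' ->]; exists (P - P'); first exact: coefs_inB.
  by rewrite !hornerE.
move=> _ _ [P hP ->] [P' hP' ->]; exists (P * P'); first exact: coefs_inM.
by rewrite hornerM.
Qed.

Lemma adjoin_sub x r : S r -> adjoin x r.
Proof. by move=> hr; exists r%:P; [apply: coefs_inC|rewrite hornerC]. Qed.

Lemma adjoin_gen x : adjoin x x.
Proof. by exists 'X; [apply: coefs_inX|rewrite hornerX]. Qed.

Lemma size_leS (P : {poly R}) n : (size P <= n.+1)%N -> P`_n = 0 -> (size P <= n)%N.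
Proof.
move=> sP P0; apply/leq_sizeP => j; rewrite leq_eqVlt => /orP[/eqP<- //|].
by move: j; apply/leq_sizeP.
Qed.

End Adjunction.

Section EulerAdjunction.
Variables (R : comNzRingType) (Q : prime_idealr R).
Variables (S : R -> Prop) (subS : subring S) (x : R).

Definition relation_of_degree (N : nat) (G : {poly R}) : Prop :=
  [/\ coefs_in S G, G.[x] \in (Q : pred R), (size G <= N.+1)%N
    & G`_N \notin (Q : pred R)].

(** Pseudo-division of $P$ by a relation of no larger degree lowers the degree
    of $P$ at the cost of a factor outside $Q$, and a leading coefficient in $Q$
    can be split off because it lies in $S\cap Q$. So the relations in the last
    hypothesis, together with $S\cap Q$, generate $S[x]\cap Q$ up to factors
    outside $Q$; when $x$ is transcendental modulo $Q$ that hypothesis is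
    vacuous. *)
Lemma euler_relations E Delta :
    derivation E -> (forall f, E f \in (Q : pred R)) ->
    (forall q, S q -> q \in (Q : pred R) -> euler Q E Delta q) ->
    (forall k P, relation_of_degree k P -> exists N G,
        [/\ (N <= k)%N, relation_of_degree N G & euler Q E Delta G.[x]]) ->
  forall q, adjoin S x q -> q \in (Q : pred R) -> euler Q E Delta q.
Proof.
move=> derE EQ eulerS minG _ [P + ->].
move: {2}(size P) (leqnn (size P)) => k; elim: k P => [|k IH] P sP hP PQ.
  move: sP; rewrite leqn0 size_poly_eq0 => /eqP->.
  by rewrite horner0; apply: euler0.
have [aQ|aQ] := boolP (P`_k \in (Q : pred R)).
  have aX : coefs_in S ((P`_k)%:P * 'X^k).
    by apply: coefs_inM => //; [apply: coefs_inC|apply: coefs_inXn].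
  have aXQ : ((P`_k)%:P * 'X^k).[x] \in (Q : pred R).
    by rewrite !hornerE mulrC; apply: idealMr.
  rewrite -[P](subrK ((P`_k)%:P * 'X^k)) hornerD; apply: eulerD => //.
    apply: IH.
    - apply: size_leS.
        rewrite (leq_trans (size_polyD _ _)) ?size_polyN // geq_max sP /=.
        rewrite mul_polyC (leq_trans (size_scale_leq _ _)) //.
        by rewrite size_polyXn.
      by rewrite coefB coefCM coefXn eqxx mulr1 subrr.
    - exact: coefs_inB.
    - by rewrite hornerD hornerN; apply: rpredB.
  by rewrite !hornerE mulrC; apply: eulerMl => //; apply: eulerS.
have [//|N [G [Nk [hG GQ sG cQ] eG]]] := minG k P.
pose H := (P`_k)%:P * ('X^(k - N) * G).
have HQ : H.[x] \in (Q : pred R) by rewrite !hornerM; do 2!apply: idealMr.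
have hH : coefs_in S H.
  apply: coefs_inM => //; first exact: coefs_inC.
  by apply: coefs_inM => //; apply: coefs_inXn.
have sH : (size H <= k.+1)%N.
  rewrite /H mul_polyC (leq_trans (size_scale_leq _ _)) //.
  have [->|G0] := eqVneq G 0; first by rewrite mulr0 size_poly0.
  rewrite mulrC size_mulXn // -[X in (_ <= X)%N](subnK (leqW Nk)) subSn // addSnnS.
  by rewrite leq_add2l.
apply: (euler_sat derE EQ cQ) => //.
rewrite -[_ * _](subrK H.[x]); apply: eulerD => //; last first.
  by rewrite !hornerM mulrA; apply: eulerMl.
have -> : G`_N * P.[x] - H.[x] = ((G`_N)%:P * P - H).[x] by rewrite !hornerE.
apply: IH.
- apply: size_leS.
    rewrite (leq_trans (size_polyD _ _)) ?size_polyN // geq_max sH andbT.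
    by rewrite mul_polyC (leq_trans (size_scale_leq _ _)).
  rewrite coefB !coefCM mulrC coefXnM ltnNge leq_subr /= subKn //.
  by rewrite subrr.
- by apply: coefs_inB => //; apply: coefs_inM => //; apply: coefs_inC.
- by rewrite hornerD hornerN hornerM; apply: rpredB => //; apply: idealMr.
Qed.

Variables (E D : R -> R) (Delta : R).
Hypothesis charQ : forall m, m.+1%:R \notin (Q : pred R).
Hypotheses (derE : derivation E) (derD : derivation D).
Hypothesis EQ : forall f, E f \in (Q : pred R).
Hypotheses (DS : forall r, S r -> D r = 0) (Dx : D x = 1).
Hypothesis eulerS : forall q, S q -> q \in (Q : pred R) -> euler Q E Delta q.

(** With $G$ a relation of minimal degree, $u = D(G(x))$ and
    $v = \Delta G(x) - E(G(x))$, the derivation $uE + vD$ takes $G(x)$ to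
    $u\Delta\,G(x)$ and agrees with $uE$ on $S$. Minimality forces
    $u = G'(x)\notin Q$: the leading coefficient of $G'$ is that of $G$ times
    the degree. Without any relation, $E$ itself will do. *)
Lemma euler_adjoin : exists u v, [/\ u \notin (Q : pred R), v \in (Q : pred R) &
  forall q, adjoin S x q -> q \in (Q : pred R) ->
    euler Q (fun f => u * E f + v * D f) (u * Delta) q].
Proof.
have derUV u v : derivation (fun f => u * E f + v * D f).
  split=> [f g|f g]; first by rewrite (derivationB derE) (derivationB derD); ring.
  by rewrite (derivationM derE) (derivationM derD); ring.
have UVQ u v : v \in (Q : pred R) ->
    forall f, u * E f + v * D f \in (Q : pred R).
  move=> vQ f; apply: rpredD; first exact: idealMr.
  by rewrite mulrC; apply: idealMr.
have eulerS' u v q : S q -> q \in (Q : pred R) ->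
    euler Q (fun f => u * E f + v * D f) (u * Delta) q.
  move=> Sq qQ; rewrite /euler DS // mulr0 addr0.
  rewrite -mulrA -mulrBr; apply: symbolicMl; exact: eulerS.
have [[N0 [G0 hG0]]|noG] :=
  pselect (exists N, exists G, relation_of_degree N G); last first.
  exists 1, 0; split=> [||q Sq qQ]; first exact: notin_prime_ideal1.
    exact: rpred0.
  apply: (euler_relations (derUV 1 0)) => //.
  - by apply: UVQ; apply: rpred0.
  - exact: eulerS'.
  by move=> k P hP; case: noG; exists k, P.
pose has_relation N := `[< exists G, relation_of_degree N G >].
have exN : exists N, has_relation N by exists N0; apply/asboolP; exists G0.
case: (ex_minnP exN) => N /asboolP[G hG] minN.
have [cG GQ sG aQ] := hG.
have dGQ : G^`().[x] \notin (Q : pred R).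
  case: N {hG} minN sG aQ => [|N] minN sG aQ.
    by move: GQ; rewrite (size1_polyC sG) hornerC (negPf aQ).
  apply/negP => dGQ; suff /asboolT/minN : exists G, relation_of_degree N G.
    by rewrite ltnn.
  exists G^`(); split=> //.
  - by move=> i; rewrite coef_deriv; apply: subringMn.
  - apply/leq_sizeP => j hj; rewrite coef_deriv.
    by move/leq_sizeP: sG => ->; rewrite ?mul0rn.
  - by rewrite coef_deriv -mulr_natr; apply: notin_prime_idealM.
have DG : D G.[x] = G^`().[x].
  by rewrite derivation_horner // ?Dx ?mulr1 // => i; apply: DS.
set u := G^`().[x]; set v := Delta * G.[x] - E G.[x].
have vQ : v \in (Q : pred R) by apply: rpredB => //; apply: idealMr.
exists u, v; split=> // q Sq qQ; apply: (euler_relations (derUV u v)) => //.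
- exact: UVQ.
- exact: eulerS'.
move=> k P hP; exists N, G; split=> //.
  by apply: minN; apply/asboolP; exists P.
rewrite /euler DG -/u (_ : _ - _ = 0); first exact: symbolic_zero.
by rewrite /v; ring.
Qed.

End EulerAdjunction.

(** * Differential operators *)

Section DifferentialOperators.
Variables (B : comNzRingType) (S : comAlgType B).
Local Notation diff_op := (@diff_op B S).

Definition commutator (D : S -> S) (s : S) : S -> S :=
  fun f => D (s * f) - s * D f.

Lemma diff_opS n (D : S -> S) :
  diff_op n.+1 D <-> linear D /\ forall s, diff_op n (commutator D s).
Proof.
split=> -[linD hD]; split=> //; last by move=> g [s /funext->]; apply: hD.
by move=> s; apply: (hD ( *%R s)); exists s.
Qed.

Lemma linear_mul (s : S) : linear ( *%R s).
Proof. by move=> a f g; rewrite mulrDr scalerAr. Qed.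

Lemma diff_op_linear n (D : S -> S) : diff_op n D -> linear D.
Proof.
by case: n => [|n] [] // s /funext->; apply: linear_mul.
Qed.

Lemma diff_op_mul n (s : S) : diff_op n ( *%R s).
Proof.
elim: n s => [|n IH] s; first by exists s.
apply/diff_opS; split=> [|t]; first exact: linear_mul.
rewrite (_ : commutator _ t = *%R 0) //.
by apply/funext => f; rewrite /commutator mulrCA subrr mul0r.
Qed.

Lemma diff_opW n (D : S -> S) : diff_op n D -> diff_op n.+1 D.
Proof.
elim: n D => [|n IH] D; first by move=> [s /funext->]; apply: diff_op_mul.
by move=> /diff_opS[linD hD]; apply/diff_opS; split=> // s; apply/IH/hD.
Qed.

Lemma diff_opD n (D D' : S -> S) :
  diff_op n D -> diff_op n D' -> diff_op n (fun f => D f + D' f).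
Proof.
elim: n D D' => [|n IH] D D'.
  by move=> [s hs] [t ht]; exists (s + t) => f; rewrite hs ht mulrDl.
move=> /diff_opS[linD hD] /diff_opS[linD' hD']; apply/diff_opS; split=> [a f g|s].
  by rewrite linD linD' scalerDr addrACA.
rewrite (_ : commutator _ s = fun f => commutator D s f + commutator D' s f);
  first exact: IH.
by apply/funext => f; rewrite /commutator; ring.
Qed.

Lemma diff_op_comp_mul n (D : S -> S) (s : S) :
  diff_op n D -> diff_op n (fun f => D (s * f)).
Proof.
elim: n D => [|n IH] D.
  by move=> [t ht]; exists (t * s) => f; rewrite ht mulrA.
move=> /diff_opS[linD hD]; apply/diff_opS; split=> [a f g|t].
  by rewrite linear_mul linD.
rewrite (_ : commutator _ t = fun f => commutator D t (s * f)); first exact: IH.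
by apply/funext => f; rewrite /commutator mulrCA.
Qed.

(** $[D\circ\delta, s] = D\circ\delta(s) + [D,s]\circ\delta$ for a
    derivation $\delta$. *)
Lemma diff_op_comp_derivation n (D delta : S -> S) :
  derivation delta -> linear delta -> diff_op n D ->
  diff_op n.+1 (fun f => D (delta f)).
Proof.
move=> derd lind; elim: n D => [|n IH] D hD; apply/diff_opS; split.
- by move=> a f g; rewrite lind (diff_op_linear hD).
- move=> s; rewrite (_ : commutator _ s = fun f => D (delta s * f)).
    exact: diff_op_comp_mul.
  apply/funext => f; case: hD => t ht.
  by rewrite /commutator !ht (derivationM derd); ring.
- by move=> a f g; rewrite lind (diff_op_linear hD).
- move=> s; rewrite (_ : commutator _ s =
      fun f => D (delta s * f) + commutator D s (delta f)); last first.
    apply/funext => f; rewrite /commutator (derivationM derd) addrA; congr (_ - _).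
    by rewrite -[X in D (X + _)]scale1r (diff_op_linear hD) scale1r.
  apply: diff_opD; first exact: diff_op_comp_mul.
  by apply: IH; move/diff_opS: hD => [].
Qed.

Section Powers.
Variable Q : prime_idealr S.

(** By $D(qg) = qD(g) + [D,q](g)$, where the commutator has order $m-1$ and
    $g\in Q^m$, the claim reduces to smaller $m$. *)
Lemma diff_op_ideal_power m (D : S -> S) f :
  diff_op m D -> ideal_power Q m.+1 f -> D f \in (Q : pred S).
Proof.
elim: m D f => [|m IH] D f hD.
  by move=> /ideal_power1 fQ; case: hD => s ->; apply: idealMr.
move/diff_opS: (hD) => [linD hC].
apply: (@ideal_powerS_ind _ Q m.+1 (fun f => D f \in (Q : pred S))) => [|a b|q g qQ gm].
- have := linD (-1) 0 0; rewrite scaler0 add0r scaleN1r addNr => ->; exact: rpred0.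
- by rewrite -[a]scale1r linD !scale1r; apply: rpredD.
- rewrite (_ : D (q * g) = commutator D q g + q * D g); last by rewrite subrK.
  apply: rpredD; first by apply: IH.
  by rewrite mulrC; apply: idealMr.
Qed.

(** From $D(sf) = sD(f) + [D,s](f)$ with $sf\in Q^{m+1}$: the left side lies in
    $Q$, and so does the commutator term by induction on the order, so that
    $sD(f)\in Q$. *)
Lemma diff_op_symbolic_power m (D : S -> S) f :
  diff_op m D -> in_symbolic_power Q m.+1 f -> D f \in (Q : pred S).
Proof.
move=> + [s sQ]; elim: m D => [|m IH] D hD hf.
  have := diff_op_ideal_power hD hf; case: hD => t ht; rewrite !ht.
  by rewrite mulrCA prime_idealrM (negPf sQ).
have := diff_op_ideal_power hD hf.
have -> : D (s * f) = commutator D s f + s * D f by rewrite subrK.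
have hC : commutator D s f \in (Q : pred S).
  by apply: IH; [case/diff_opS: hD | apply: ideal_powerW].
by rewrite rpredDl // prime_idealrM (negPf sQ).
Qed.

End Powers.

Lemma differential_powerW (I : {pred S}) n f :
  differential_power B I n.+1 f -> differential_power B I n f.
Proof. by case: n => // n hf D hD; apply: hf; apply: diff_opW. Qed.

Lemma differential_power_derivation (I : {pred S}) n (delta : S -> S) f :
    derivation delta -> linear delta ->
  differential_power B I n.+2 f -> differential_power B I n.+1 (delta f).
Proof.
by move=> hd hl hf D hD; apply: (hf (fun f => D (delta f)));
  apply: diff_op_comp_derivation.
Qed.

End DifferentialOperators.

(** * Polynomial rings *)

Section PolynomialRing.
Variables (A : comNzRingType) (d : nat).
Local Notation R := {mpoly A[d]}.

Lemma mderiv_derivation i : derivation (mderiv i : R -> R).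
Proof. by split=> f g; [apply: mderivB|apply: mderivM]. Qed.

(** The subalgebra generated by the variables listed in $s$, as iterated
    polynomial expressions in one variable: the form in which euler_adjoin
    reaches it. *)
Fixpoint polys_in (s : seq 'I_d) : R -> Prop :=
  if s is i :: s' then adjoin (polys_in s') 'X_i
  else fun f => exists a : A, f = a%:MP_[d].

Lemma subring_polys_in s : subring (polys_in s).
Proof.
elim: s => [|i s IH] /=; last exact: subring_adjoin.
split; first by exists 1; rewrite mpolyC1.
  by move=> _ _ [a ->] [b ->]; exists (a - b); rewrite mpolyCB.
by move=> _ _ [a ->] [b ->]; exists (a * b); rewrite mpolyCM.
Qed.

Lemma polys_inC s a : polys_in s a%:MP_[d].
Proof.
elim: s => [|i s IH] /=; first by exists a.
by apply: adjoin_sub => //; apply: subring_polys_in.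
Qed.

Lemma polys_inX s i : i \in s -> polys_in s 'X_i.
Proof.
elim: s => //= j s IH; rewrite inE => /orP[/eqP->|/IH hi].
  by apply: adjoin_gen; apply: subring_polys_in.
by apply: adjoin_sub => //; apply: subring_polys_in.
Qed.

Lemma polys_in_enum f : polys_in (enum 'I_d) f.
Proof.
have sub := subring_polys_in (enum 'I_d).
rewrite (mpolyE f); apply: big_ind => [|a b|m _].
- exact: subring0.
- exact: subringD.
rewrite -mul_mpolyC; apply: (subringM sub); first exact: polys_inC.
rewrite mpolyXE_id; apply: big_ind => [|a b|i _].
- exact: subring1.
- exact: subringM.
elim: (m i) => [|n IH]; first by rewrite expr0; apply: subring1.
by rewrite exprS; apply: subringM => //; apply: polys_inX; rewrite mem_enum.
Qed.

Lemma mderivX1 i j : ('X_i : R)^`M(j) = (i == j)%:R.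
Proof.
rewrite mderivX mnm1E; case: eqVneq => [->|_]; last by rewrite scale0r.
by rewrite scale1r -{1}[U_(j)%MM]add0m addmK mpolyX0.
Qed.

Lemma mderiv_polys_in s j f : j \notin s -> polys_in s f -> f^`M(j) = 0.
Proof.
elim: s f => [|i s IH] f /=; first by move=> _ [a ->]; rewrite mderivC.
rewrite inE negb_or => /andP[ji js] [P hP ->].
rewrite (derivation_horner (mderiv_derivation j)) => [|k]; last exact: IH.
by rewrite mderivX1 eq_sym (negPf ji) mulr0.
Qed.

Variables (Q : prime_idealr R).
Hypothesis charQ : forall m, m.+1%:R \notin (Q : pred R).
Hypothesis QA : forall a, a%:MP_[d] \in (Q : pred R) -> a = 0.

Definition vector_field (e : 'I_d -> R) (f : R) : R := \sum_i e i * f^`M(i).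

Lemma vector_field_derivation e : derivation (vector_field e).
Proof.
split=> f g; rewrite /vector_field.
  by rewrite -sumrB; apply: eq_bigr => i _; rewrite mderivB mulrBr.
rewrite mulr_suml mulr_sumr -big_split /=; apply: eq_bigr => i _.
by rewrite mderivM; ring.
Qed.

Lemma vector_field_in e f :
  (forall i, e i \in (Q : pred R)) -> vector_field e f \in (Q : pred R).
Proof.
by move=> eQ; apply: rpred_sum => i _; rewrite mulrC; apply: idealMr.
Qed.

(** On the constants the condition is empty because $Q\cap A = 0$, and
    euler_adjoin adds one variable at a time. Its hypothesis that $\partial_i$
    vanishes on the earlier variables is where distinctness of the listed
    variables enters. *)
Lemma exists_euler : exists Delta e, [/\ Delta \notin (Q : pred R),
  (forall i, e i \in (Q : pred R)) &
  forall q, q \in (Q : pred R) -> euler Q (vector_field e) Delta q].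
Proof.
suff [Delta [e [DQ eQ he]]] : exists Delta e, [/\ Delta \notin (Q : pred R),
    (forall i, e i \in (Q : pred R)) & forall q, polys_in (enum 'I_d) q ->
    q \in (Q : pred R) -> euler Q (vector_field e) Delta q].
  by exists Delta, e; split=> // q; apply: he; apply: polys_in_enum.
elim: (enum 'I_d) (enum_uniq 'I_d) => [_|i s IH /= /andP[inots /IH]].
  exists 1, (fun=> 0); split=> [||q [a ->] /QA->].
  - exact: notin_prime_ideal1.
  - by move=> i; apply: rpred0.
  - rewrite mpolyC0; apply: euler0; exact: vector_field_derivation.
move=> [Delta [e [DQ eQ he]]].
have [||||||u [v [uQ vQ huv]]] := @euler_adjoin R Q _ (subring_polys_in s) 'X_i
   (vector_field e) (mderiv i) Delta charQ.
- exact: vector_field_derivation.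
- exact: mderiv_derivation.
- by move=> f; apply: vector_field_in.
- by move=> r; apply: mderiv_polys_in.
- by rewrite mderivX1 eqxx.
- exact: he.
exists (u * Delta), (fun j => u * e j + v * (j == i)%:R); split.
- exact: notin_prime_idealM.
- move=> j; apply: rpredD; first exact: idealMr.
  by rewrite mulrC; apply: idealMr.
- move=> q hq qQ; have := huv q hq qQ; rewrite /euler.
  suff -> : vector_field (fun j => u * e j + v * (j == i)%:R) q =
      u * vector_field e q + v * q^`M(i) by [].
  rewrite /vector_field mulr_sumr.
  under eq_bigr do rewrite mulrDl.
  rewrite big_split /=; congr (_ + _); first by apply: eq_bigr => j _; rewrite mulrA.
  rewrite (bigD1 i) //= eqxx mulr1 big1 ?addr0 // => j /negPf->.
  by rewrite mulr0 mul0r.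
Qed.

(** In the step, $(n+1)\Delta f = E(f) - (E(f) - (n+1)\Delta f)$. The first term
    lies in $Q\cdot Q^{(n+1)}$ by induction applied to the $\partial_i f$, the
    second in $Q^{(n+2)}$ by Euler's identity for $f\in Q^{(n+1)}$. *)
Lemma differential_power_symbolic n f :
  differential_power A Q n.+1 f -> in_symbolic_power Q n.+1 f.
Proof.
have [Delta [e [DQ eQ he]]] := exists_euler.
elim: n f => [|n IH] f hf.
  by apply/symbolic1; apply: (hf id); exists 1 => g; rewrite mul1r.
have fn := IH f (differential_powerW hf).
have nDQ : n.+1%:R * Delta \notin (Q : pred R) by apply: notin_prime_idealM.
apply: (symbolic_sat nDQ).
rewrite -[X in in_symbolic_power _ _ X](subKr (vector_field e f)).
apply: symbolicB; last first.
  apply: euler_symbolic => //; first exact: vector_field_derivation.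
  by move=> g; apply: vector_field_in.
apply: symbolic_sum => i; rewrite -[n.+2]/(1 + n.+1)%N.
apply: symbolicM; first by apply/symbolic1.
apply: IH; apply: differential_power_derivation => //.
  exact: mderiv_derivation.
exact: mderiv_is_linear.
Qed.

Lemma symbolic_power_eq_differential_power n :
  symbolic_power Q n.+1 = differential_power A Q n.+1.
Proof.
apply/seteqP; split=> f.
  by move=> /symbolic_powerP fn D hD; apply: (diff_op_symbolic_power hD fn).
by move=> hf; apply/symbolic_powerP/differential_power_symbolic.
Qed.

End PolynomialRing.

(** * Characteristic zero for the p-adic integers *)

Lemma padic_natr_res p m n : (m%:R : padic_int p) n = m%:R.
Proof. by elim: m => [|m IH] //; rewrite -!natr1 -IH. Qed.

(** The image of $m+1$ in $\mathbb{Z}/p^{m+1}$ is already nonzero, because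
    $m+1 < p^{m+1}$. *)
Lemma padic_natr_neq0 p m : prime p -> m.+1%:R != 0 :> padic_int p.
Proof.
move=> p_pr; apply/eqP => /(congr1 (fun x : padic_int p => x m)).
rewrite padic_natr_res => /(congr1 val) /=; have p1 := prime_gt1 p_pr.
have pm : (m.+1 < p ^ m.+1)%N by apply: ltn_expl.
rewrite val_Zp_nat ?modn_small //.
by apply: leq_ltn_trans pm.
Qed.

Theorem theorem1 (A : comNzRingType)
    (hA : A = int \/ exists p : nat, prime p /\ A = padic_int p)
    (d : nat) (Q : prime_idealr {mpoly A[d]})
    (hQ : forall a : A, a%:MP_[d] \in (Q : pred _) <-> a = 0)
    (n : nat) (hn : (1 <= n)%N) :
  symbolic_power Q n = differential_power A Q n.
Proof.
have char0 : forall m, m.+1%:R != 0 :> A.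
  move=> m; case: hA => [->|[p [p_pr ->]]]; last exact: padic_natr_neq0.
  by rewrite [_ == _]Num.Theory.pnatr_eq0.
case: n hn => // n _; apply: symbolic_power_eq_differential_power => [m|a /hQ//].
by apply/negP; rewrite -mpolyC_nat => /hQ/eqP; apply/negP.
Qed.
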